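(* Let $G$ be a finite undirected graph (possibly with loops and multiple edges) with nonempty vertex set $V$ and edge set $E$, and let $b\in\mathbb{R}^V$ have all entries nonnegative. Then a necessary and sufficient condition for $\mathcal{P}(G,b)$ to be nonempty is that $\sum_{v\in V_1}b_v\ge\sum_{v\in V_3}b_v$ for all pairwise disjoint (possibly empty) sets $V_1,V_2,V_3$ such that $V=V_1\cup V_2\cup V_3$ and $G[V_2\cup V_3,V_3]=\emptyset$.
   Context: $\delta_G(v)$ denotes the set of edges of $G$ incident with the vertex $v$; a loop at $v$ appears once (not twice) in $\delta_G(v)$. The edge set $E$ may be empty. The fractional perfect $b$-matching polytope is $\mathcal{P}(G,b)=\{x\in\mathbb{R}^E \mid x_e\ge 0 \text{ for each } e\in E,\ \sum_{e\in\delta_G(v)}x_e=b_v \text{ for each } v\in V\}$. When $E=\emptyset$, $\mathbb{R}^\emptyset=\{0\}$, so $\mathcal{P}(G,b)=\{0\}$ if $b=0$ and $\mathcal{P}(G,b)=\emptyset$ otherwise. For $U,W\subset V$, $G[U,W]$ denotes the set of all edges of $G$ whose endpoints are $u$ and $w$ for some $u\in U$ and $w\in W$ (a loop at $v$ has both endpoints equal to $v$). *)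

(* Defs.v *)
From mathcomp Require Import all_boot all_order all_algebra.
From mathcomp Require Import boolp classical_sets reals.

Set Implicit Arguments.
Unset Strict Implicit.
Unset Printing Implicit Defensive.

Import Order.TTheory GRing.Theory Num.Theory.
Local Open Scope ring_scope.

(* Finite undirected multigraphs with loops. Edges form a type of their own, so
   parallel edges are distinct edges with the same endpoints; a loop at v is an
   edge e with endpoints e = [set v]. *)
Record multigraph := Multigraph {
  vertex : finType;
  edge : finType;
  endpoints : edge -> {set vertex};
  endpointsP : forall e, (0 < #|endpoints e| <= 2)%N }.

(* A set of edges, so a loop at v is counted once. *)
Definition delta (G : multigraph) (v : vertex G) : {set edge G} :=
  [set e : edge G | v \in endpoints e].

(* G[U, W]; taking u = w accounts for the loops at vertices of U :&: W. *)
Definition edges_between (G : multigraph) (U W : {set vertex G}) :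
    {set edge G} :=
  [set e : edge G | [exists u in U, exists w in W,
                       endpoints e == [set u; w]]].

(* P(G, b). *)
Definition fractional_perfect_b_matching_polytope (R : realType) (G : multigraph)
    (b : {ffun vertex G -> R}) : set {ffun edge G -> R} :=
  [set x : {ffun edge G -> R} |
    (forall e : edge G, 0 <= x e) /\
    (forall v : vertex G, \sum_(e in delta v) x e = b v)]%classic.

(* Main.v *)
(** Necessity: an edge meeting [V3] has one end in [V3] and the other in [V1],
    so each edge contributes at least as much to the sum over [V1] as to the sum
    over [V3].
    Sufficiency: if the polytope is empty, Farkas' lemma (by Bartl's induction
    on the number of inequalities) yields a vertex weighting [y] with
    nonnegative total on every edge and [\sum_v y v * b v < 0].  Let [V1],
    [V2], [V3] be the sets where [y] is positive, zero, negative; no edge joins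
    [V2 :|: V3] to [V3], so moving every nonzero [y v] towards [0] by the least
    nonzero [`|y v|] does not increase [\sum_v y v * b v].  It also keeps the
    edge totals nonnegative and shrinks the support, so by induction that sum
    was nonnegative. *)
Require Import Defs.
From mathcomp Require Import all_boot all_order all_algebra.
From mathcomp Require Import boolp classical_sets reals.
From mathcomp Require Import ring lra.

Set Implicit Arguments.
Unset Strict Implicit.
Unset Printing Implicit Defensive.

Import Order.TTheory GRing.Theory Num.Theory.
Local Open Scope ring_scope.

Lemma sum_mulrBZ (F : comNzRingType) (V : finType) (x y z : V -> F) (k : F) :
  \sum_v x v * (y v - k * z v) =
  \sum_v x v * y v - k * \sum_v x v * z v.
Proof.
by rewrite mulr_sumr -sumrB; apply: eq_bigr => v _; ring.
Qed.

Lemma sum_mulBZr (F : comNzRingType) (V : finType) (x y z : V -> F) (k : F) :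
  \sum_v (y v - k * z v) * x v =
  \sum_v y v * x v - k * \sum_v z v * x v.
Proof.
by rewrite mulr_sumr -sumrB; apply: eq_bigr => v _; ring.
Qed.

(** If the tail yields an [x] that is negative on [a i], then [a i] is transversal to the hyperplane
    orthogonal to [x]. Projecting along [a i] onto that hyperplane leaves a system indexed by the
    tail alone, and either of its outcomes lifts back. *)
Lemma farkas (F : realFieldType) (I : eqType) (V : finType) (r : seq I)
    (a : I -> V -> F) (c : V -> F) :
  uniq r ->
  (exists2 l : I -> F, forall i, 0 <= l i &
     forall v, \sum_(i <- r) l i * a i v = c v) \/
  (exists2 x : V -> F, forall i, i \in r -> 0 <= \sum_v x v * a i v &
     \sum_v x v * c v < 0).
Proof.
elim: r a c => [|i r IHr] a c /=.
  move=> _; have [c0|] := boolP [forall v, c v == 0].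
    by left; exists (fun=> 0) => // v; rewrite big_nil (eqP (forallP c0 v)).
  rewrite negb_forall => /existsP[v cv]; right; exists (fun v => - c v) => //.
  rewrite (bigD1 v) //= mulNr ltr_wnDr ?oppr_lt0 ?lt_def ?mulf_neq0 //=.
    by apply: sumr_le0 => w _; rewrite mulNr oppr_le0 sqr_ge0.
  exact: sqr_ge0.
move=> /andP[ri ur].
(* Since [i] is not in [r], its coefficient can be set freely without disturbing the tail. *)
have ext (l : I -> F) k v :
    \sum_(j <- i :: r) (if j == i then k else l j) * a j v =
    k * a i v + \sum_(j <- r) l j * a j v.
  rewrite big_cons eqxx; congr (_ + _); apply: eq_big_seq => j rj.
  by case: eqP rj ri => // -> ->.
have [[l l0 lc]|[x xr xc]] := IHr a c ur.
  left; exists (fun j => if j == i then 0 else l j) => [j|v].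
    by case: eqP.
  by rewrite ext mul0r add0r.
have [xi|xi] := leP 0 (\sum_v x v * a i v).
  by right; exists x => // j; rewrite inE => /predU1P[->|/xr].
set s := \sum_v x v * a i v in xi.
(* These scalars make [a j - p j * a i] and [c - q * a i] orthogonal to [x]. As [s < 0],
   [p j <= 0 <= q], so the coefficient of [a i] found below is nonnegative. *)
pose p j := (\sum_v x v * a j v) / s.
pose q := (\sum_v x v * c v) / s.
have s0 : s != 0 by rewrite lt_eqF.
have p0 j : j \in r -> p j <= 0.
  by move=> /xr; rewrite /p => ?; rewrite mulr_ge0_le0 // invr_le0 ltW.
have q0 : 0 <= q by rewrite /q mulr_le0 // ?invr_le0 ltW.
have [[l l0 lc]|[y yr yc]] :=
  IHr (fun j v => a j v - p j * a i v) (fun v => c v - q * a i v) ur.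
- left; exists (fun j => if j == i then q - \sum_(j <- r) l j * p j else l j).
    move=> j; case: eqP => // _; rewrite subr_ge0 (le_trans _ q0) //.
    by rewrite big_seq; apply: sumr_le0 => k /p0; apply: mulr_ge0_le0.
  move=> v; have /esym/eqP := lc v; rewrite subr_eq => /eqP->.
  rewrite ext mulrBl mulr_suml.
  under [X in _ = X + _]eq_bigr => j _ do rewrite mulrBr mulrA.
  by rewrite sumrB; ring.
(* Correcting [y] by a multiple of [x] makes it orthogonal to [a i]; its pairing with [d] is then
   that of [y] with the projection of [d]. *)
- have z_dot (d : V -> F) :
      \sum_v (y v - (\sum_w y w * a i w) / s * x v) * d v =
      \sum_v y v * (d v - (\sum_w x w * d w) / s * a i v).
    by rewrite sum_mulBZr sum_mulrBZ; ring.
  right; exists (fun v => y v - (\sum_w y w * a i w) / s * x v) => [j|].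
    rewrite inE => /predU1P[->|/yr]; last by rewrite z_dot.
    by rewrite sum_mulBZr -/s divfK // subrr.
  by rewrite z_dot.
Qed.

(** The case [u = w] is a loop. *)
Lemma endpointsE (G : multigraph) (e : edge G) :
  exists u w, endpoints e = [set u; w].
Proof.
have := endpointsP e; case E: #|endpoints e| => [|[|[|]]] // _.
  by have /eqP/cards1P[u ->] := E; exists u, u; rewrite finset.setUid.
by have /eqP/cards2P[u [w [_ ->]]] := E; exists u, w.
Qed.

Lemma sumr_set2 (F : nmodType) (V : finType) (y : V -> F) (u w : V) : u != w ->
  \sum_(v in [set u; w]) y v = y u + y w.
Proof. by move=> uw; rewrite big_setU1 ?inE //= big_set1. Qed.

(** Double counting of incidences: [x e] occurs once for each end of [e] in [A]. *)
Lemma sum_exchange_endpoints (F : nmodType) (G : multigraph)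
    (A : {set vertex G}) (x : edge G -> F) :
  \sum_(v in A) \sum_(e in delta v) x e =
  \sum_e x e *+ #|endpoints e :&: A|.
Proof.
rewrite (exchange_big_dep predT) //=; apply: eq_bigr => e _.
rewrite sumr_const; congr (_ *+ _).
by apply: eq_card => v; rewrite unfold_in !inE andbC.
Qed.

Lemma card_endpoints_le (G : multigraph) (V1 V2 V3 : {set vertex G})
    (e : edge G) :
  [set: vertex G] = V1 :|: V2 :|: V3 -> [disjoint V1 & V3] ->
  edges_between (V2 :|: V3) V3 = finset.set0 ->
  (#|endpoints e :&: V3| <= #|endpoints e :&: V1|)%N.
Proof.
move=> covV dis13 noE.
have [->|/set0Pn[v /setIP[ve v3]]] := eqVneq (endpoints e :&: V3) finset.set0.
  by rewrite cards0.
have [u eE] : exists u, endpoints e = [set u; v].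
  have [u [w eE]] := endpointsE e; move: ve; rewrite eE.
  by move=> /set2P[->|->]; [exists w; rewrite finset.setUC|exists u].
have u1 : u \in V1.
  apply/negPn/negP => u1; suff: e \in edges_between (V2 :|: V3) V3.
    by rewrite noE inE.
  rewrite inE; apply/existsP; exists u; apply/andP; split.
    by move/setP/(_ u): covV; rewrite !inE (negPf u1) => <-.
  by apply/existsP; exists v; rewrite v3 eE eqxx.
(* The end [u] lies in [V1], hence outside [V3], so [v] is the only end in [V3]. *)
apply: (@leq_trans 1).
  rewrite -(cards1 v) subset_leq_card //; apply/fintype.subsetP => z.
  rewrite eE !inE => /andP[/orP[/eqP->|//]].
  by rewrite (disjointFr dis13 u1).
by rewrite card_gt0; apply/set0Pn; exists u; rewrite eE !inE eqxx u1.
Qed.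

Lemma shrink_ge0 (F : realFieldType) (y t : F) :
  (y != 0 -> t <= `|y|) -> 0 <= y ->
  0 <= y - t * Num.sg y.
Proof.
move=> ty; rewrite le_eqVlt => /predU1P[<-|y0].
  by rewrite sgr0 mulr0 subr0.
move: ty; rewrite gt_eqF // gtr0_sg // gtr0_norm // => /(_ isT).
by rewrite mulr1 subr_ge0.
Qed.

(** With opposite signs the two shifts by [t] cancel and the total is unchanged; with both terms
    nonnegative neither crosses [0]. *)
Lemma shrinkD_ge0 (F : realFieldType) (y z t : F) :
  (y != 0 -> t <= `|y|) -> (z != 0 -> t <= `|z|) ->
  0 <= y + z -> 0 <= (y - t * Num.sg y) + (z - t * Num.sg z).
Proof.
move=> ty tz yz; have [y0|y0] := leP 0 y; have [z0|z0] := leP 0 z.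
- by rewrite addr_ge0 // shrink_ge0.
- have y_gt0 : 0 < y by lra.
  by rewrite gtr0_sg // ltr0_sg //; lra.
- have z_gt0 : 0 < z by lra.
  by rewrite ltr0_sg // gtr0_sg //; lra.
- by lra.
Qed.

Definition triple_condition (F : realFieldType) (G : multigraph)
    (b : vertex G -> F) :=
  forall V1 V2 V3 : {set vertex G},
  [disjoint V1 & V2] -> [disjoint V1 & V3] -> [disjoint V2 & V3] ->
  [set: vertex G] = V1 :|: V2 :|: V3 ->
  edges_between (V2 :|: V3) V3 = finset.set0 ->
  \sum_(v in V3) b v <= \sum_(v in V1) b v.

(** This sum is the rate at which the weighted sum of [b] drops when [y] is moved towards [0]. *)
Lemma sum_sg_ge0 (F : realFieldType) (G : multigraph)
    (b y : vertex G -> F) :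
  triple_condition b ->
  (forall e : edge G, 0 <= \sum_(v in endpoints e) y v) ->
  0 <= \sum_v Num.sg (y v) * b v.
Proof.
move=> triple ye.
have -> : \sum_v Num.sg (y v) * b v =
    \sum_(v in [set v | 0 < y v]) b v - \sum_(v in [set v | y v < 0]) b v.
  rewrite [X in _ = X - _]big_mkcond [X in _ = _ - X]big_mkcond -sumrB;
  apply: eq_bigr => v _; rewrite !inE.
  by case: sgrP => _; rewrite ?mul0r ?mul1r ?mulN1r ?subr0 ?sub0r.
rewrite subr_ge0; apply: (triple _ [set v | y v == 0]).
- by rewrite -setI_eq0; apply/eqP/setP=> v; rewrite !inE; case: ltgtP.
- by rewrite -setI_eq0; apply/eqP/setP=> v; rewrite !inE; case: ltgtP.
- by rewrite -setI_eq0; apply/eqP/setP=> v; rewrite !inE; case: ltgtP.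
- by apply/setP=> v; rewrite !inE; case: ltgtP.
(* An edge with one end of weight [<= 0] and the other of weight [< 0] would have negative total; a
   loop counts its weight once. *)
apply/setP=> e; rewrite inE [RHS]inE; apply/existsP => -[u /andP[]].
rewrite !inE -le_eqVlt => u0 /existsP[w /andP[]]; rewrite inE => w0 /eqP eE.
have := ye e; rewrite eE; case: (eqVneq u w) => [->|uw].
  by rewrite finset.setUid big_set1 leNgt w0.
by rewrite sumr_set2 //; lra.
Qed.

Lemma sum_weight_ge0 (F : realFieldType) (G : multigraph)
    (b y : vertex G -> F) :
  triple_condition b ->
  (forall e : edge G, 0 <= \sum_(v in endpoints e) y v) ->
  0 <= \sum_v y v * b v.
Proof.
move=> triple; have [n] := ubnP #|[set v | y v != 0]|.
elim: n y => // n IHn y ltn ye.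
have [/existsP[v0 yv0]|] := boolP [exists v, y v != 0]; last first.
  rewrite negb_exists => /forallP y0; rewrite big1 // => v _.
  by have := y0 v; rewrite negbK => /eqP ->; rewrite mul0r.
(* The least [|y v|] on the support is the largest step at which no weight changes sign; it sends
   [v1] to [0]. *)
have [v1 yv1 minv1] :=
  arg_minP (P := fun v => y v != 0) (fun v => `|y v|) yv0.
set t := `|y v1| in minv1; pose z v := y v - t * Num.sg (y v).
have -> : \sum_v y v * b v = \sum_v z v * b v + t * \sum_v Num.sg (y v) * b v.
  by rewrite sum_mulBZr subrK.
rewrite addr_ge0 ?mulr_ge0 ?(sum_sg_ge0 triple) ?normr_ge0 //; apply: IHn.
  rewrite ltnS in ltn; apply: leq_trans ltn; apply: proper_card.
  apply/properP; split.
    apply/fintype.subsetP => v; rewrite !inE /z.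
    by apply: contra_neq => ->; rewrite sgr0 mulr0 subr0.
  by exists v1; rewrite !inE // negbK /z [t * _]mulrC -numEsg subrr.
move=> e; have := ye e; have [u [w ->]] := endpointsE e.
case: (eqVneq u w) => [->|uw].
  by rewrite finset.setUid !big_set1; apply: shrink_ge0; exact: minv1.
by rewrite !sumr_set2 //; apply: shrinkD_ge0; exact: minv1.
Qed.

Theorem theorem6 (R : realType) (G : multigraph) (b : {ffun vertex G -> R})
    (V_neq0 : (0 < #|vertex G|)%N) (b_ge0 : forall v : vertex G, 0 <= b v) :
  (fractional_perfect_b_matching_polytope b !=set0)%classic
  <->
  (forall V1 V2 V3 : {set vertex G},
     [disjoint V1 & V2] -> [disjoint V1 & V3] -> [disjoint V2 & V3] ->
     [set: vertex G] = V1 :|: V2 :|: V3 ->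
     edges_between (V2 :|: V3) V3 = finset.set0 ->
     \sum_(v in V1) b v >= \sum_(v in V3) b v).
Proof.
split=> [[x [x0 xb]] V1 V2 V3 _ dis13 _ covV noE|triple].
  under eq_bigr => v _ do rewrite -xb.
  under [leRHS]eq_bigr => v _ do rewrite -xb.
  rewrite !sum_exchange_endpoints; apply: ler_sum => e _.
  by apply: ler_wpMn2l => //; exact: card_endpoints_le covV dis13 noE.
(* The vectors are the incidence vectors of the edges and the target is [b]: [l] is a point of the
   polytope, [y] a vertex weighting refuting one. *)
have [[l l0 lb]|[y ye yb]] := farkas
  (fun (e : edge G) v => (v \in endpoints e)%:R) b (index_enum_uniq (edge G)).
  exists [ffun e => l e]; split=> [e|v]; first by rewrite ffunE.
  rewrite -lb big_mkcond; apply: eq_bigr => e _.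
  by rewrite inE ffunE; case: ifP; rewrite ?mulr1 ?mulr0.
suff : 0 <= \sum_v y v * b v by rewrite leNgt yb.
apply: (sum_weight_ge0 (b := b)) => // e; rewrite big_mkcond /=.
have := ye e (mem_index_enum e); congr (_ <= _); apply: eq_bigr => v _.
by case: ifP; rewrite ?mulr1 ?mulr0.
Qed.
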